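(* Let $p$ be a prime and let $G$ be a non-trivial finite metacyclic $p$-group. Then $G$ is a Beauville group if and only if $p\ge 5$ and $G$ is a semidirect product of two cyclic groups of the same order.
   Context: For $x,y\in G$ let $\Sigma(x,y)=\bigcup_{g\in G}\big(\langle x\rangle^g\cup\langle y\rangle^g\cup\langle xy\rangle^g\big)$. A Beauville structure for $G$ is a pair of generating sets $\{x_1,y_1\}$, $\{x_2,y_2\}$ of $G$ such that $\Sigma(x_1,y_1)\cap\Sigma(x_2,y_2)=1$. $G$ is a Beauville group if it has a Beauville structure. A group is metacyclic if it has a cyclic normal subgroup with cyclic quotient. Semidirect products include direct products. *)

(* Defs.v *)
From mathcomp Require Import all_boot all_fingroup all_solvable.

Set Implicit Arguments.
Unset Strict Implicit.
Unset Printing Implicit Defensive.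

Local Open Scope group_scope.

Definition Sigma (gT : finGroupType) (G : {set gT}) (x y : gT) : {set gT} :=
  \bigcup_(g in G) (<[x]> :^ g :|: <[y]> :^ g :|: <[x * y]> :^ g).

Definition Beauville_structure (gT : finGroupType) (G : {set gT})
    (x1 y1 x2 y2 : gT) : Prop :=
  [/\ <<[set x1; y1]>> = G, <<[set x2; y2]>> = G
    & Sigma G x1 y1 :&: Sigma G x2 y2 = 1].

Definition Beauville_group (gT : finGroupType) (G : {set gT}) : Prop :=
  exists x1 y1 x2 y2 : gT, Beauville_structure G x1 y1 x2 y2.

(* [K ><| H = G] also covers direct products (H acting trivially on K). *)
Definition sdprod_cyclic_same_order (gT : finGroupType) (G : {set gT}) : Prop :=
  exists K H : {group gT},
    [/\ K ><| H = G, cyclic K, cyclic H & #|K| = #|H|].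

(* Main.v *)
Require Import Defs.
From mathcomp Require Import all_boot all_fingroup all_solvable.
From mathcomp Require Import zify.

Set Implicit Arguments.
Unset Strict Implicit.
Unset Printing Implicit Defensive.

(** Everything rests on one power formula. If a p-element g acts on a cyclic
p-group N as x |-> x ^+ s, then s = 1 mod p by Fermat, and
  (g x) ^+ (p ^ t) = g ^+ (p ^ t) * x ^+ (p ^ t * c),
where p ^ t * c is the geometric sum 1 + s + ... + s ^ (p ^ t - 1); moreover
c = 1 mod p when p is odd, or when s = 1 mod 4 and p = 2 ([expg_pow_mul]).

Suppose that the metacyclic p-group G is Beauville; choose N nontrivial, normal
and cyclic with G / N cyclic, and let z be an element of order p in N. The
element z lies outside one of the two Sigma sets, say the second; as z lies in
every nontrivial subgroup of N, each of x2, y2 and x2 y2 generates a cyclic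
group that meets N trivially. One of x2, y2 generates G modulo N; call it u.
Then u generates a complement of N, and the other element of the pair is
u ^+ i * a with <[a]> = N. Let #[u] = p ^ m.
- An element g of the first triple also generates G modulo N. If #|N| divided
  p ^ (m - 1), then g ^+ (p ^ (m - 1)) would lie in <[u]>, so be 1, so G would
  be too small. Hence #[u] divides #|N|.
- If p is odd, the p ^ m-th power of u ^+ i * a lies in N, so is 1, and the
  formula makes #|N| divide p ^ m.
- If p = 2, one of u ^+ i * a and u ^+ i.+1 * a involves an even power of u,
  which acts on N by an exponent that is 1 mod 4; the same computation then
  makes #|N| divide 2 ^ (m - 1), a contradiction.
This is [Beauville_metacyclic_sdprod].

Now let p be odd and G the semidirect product of <[a]> and <[b]>, both of order
p ^ (e + 1). The formula shows that x |-> x ^+ (p ^ e) is a morphism from G to a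
central elementary abelian group of order p ^ 2 ([pow_morphism]). Its values
tell which subgroups of order p the cyclic subgroups contain, so a Beauville
structure amounts to six distinct lines, three for each triple, in a plane over
the field with p elements. There are p + 1 lines, too few if p = 3
([sdprod_3group_not_Beauville]). If p >= 5, the triples on a, b and on
a b ^ 2, a b ^ 4 give the lines of (1, 0), (0, 1), (1, 1) and of (1, 2), (1, 4),
(2, 6): the determinants to be nonzero mod p are, up to sign, 1, 2, 3, 4 and 6
([sdprod_Beauville]). *)

(** * Geometric sums modulo powers of a prime *)

Lemma modn1_decomp d s : 1 < d -> s = 1 %[mod d] -> exists c, s = 1 + d * c.
Proof.
move=> d_gt1 s1.
have s_gt0: 0 < s.
  by case: s s1 => // /esym; rewrite mod0n modn_small // ; lia.
exists ((s - 1) %/ d); rewrite mulnC divnK ?subnKC //.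
by rewrite -eqn_mod_dvd //; apply/eqP.
Qed.

Lemma geom_sum_mul s m n :
  \sum_(i < m * n) s ^ i = (\sum_(i < m) s ^ i) * \sum_(j < n) (s ^ m) ^ j.
Proof.
elim: n => [|n IHn]; first by rewrite muln0 !big_ord0 muln0.
rewrite mulnSr big_split_ord /= IHn big_ord_recr /= mulnDr; congr (_ + _).
rewrite big_distrl /=; apply: eq_bigr => i _.
by rewrite -expnM -expnD addnC.
Qed.

Lemma modn_exp1 d s k : s = 1 %[mod d] -> s ^ k = 1 %[mod d].
Proof. by move=> s1; rewrite -modnXm s1 modnXm exp1n. Qed.

Lemma sqr_mod4 s : s = 1 %[mod 2] -> s ^ 2 = 1 %[mod 2 ^ 2].
Proof.
move=> s1; have [d ->] := modn1_decomp (ltnSn 1) s1.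
by rewrite (_ : _ ^ 2 = (d + d ^ 2) * 2 ^ 2 + 1) ?modnMDl //; nia.
Qed.

(** With s = 1 + p d, the sum is p + p d 'C(p, 2) modulo p ^ 2. So c is
1 + d 'C(p, 2) mod p, and p divides 'C(p, 2) if p is odd, while p divides d if
s = 1 mod p ^ 2; for p = 2 and s = 3 mod 4 the conclusion on c fails. *)
Lemma geom_sum_prime p s :
    prime p -> s = 1 %[mod p] ->
  exists2 c, \sum_(i < p) s ^ i = p * c
    & odd p \/ s = 1 %[mod p ^ 2] -> c = 1 %[mod p].
Proof.
move=> p_pr s1; have p_gt1 := prime_gt1 p_pr; have p_gt0 := prime_gt0 p_pr.
have [d Ds] : exists d, s = 1 + p * d by apply: modn1_decomp.
have expE i : exists e, s ^ i = 1 + p * d * i + p ^ 2 * e.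
  elim: i => [|i [e IHi]]; first by exists 0; rewrite !muln0.
  exists (d * d * i + e * s); rewrite expnSr IHi Ds; nia.
have [f Df]: exists f, \sum_(i < p) s ^ i = p * (1 + d * 'C(p, 2) + p * f).
  suff /(_ p)[f ->]: forall n, exists f,
      \sum_(i < n) s ^ i = n + p * d * 'C(n, 2) + p ^ 2 * f.
    by exists f; rewrite !mulnDr muln1 !mulnA mulnn.
  elim=> [|n [f IHn]]; first by exists 0; rewrite big_ord0 bin0n !muln0.
  have [e De] := expE n; exists (f + e).
  rewrite big_ord_recr /= IHn De binS bin1; move: 'C(n, 2) => b; nia.
exists (1 + d * 'C(p, 2) + p * f) => // cond.
have /dvdnP[k ->]: p %| d * 'C(p, 2).
  case: cond => [p_odd | s1sq].
    apply/dvdn_mull/prime_dvd_bin => //=.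
    by case: (p =P 2) p_odd => [-> //|]; lia.
  apply: dvdn_mulr.
  move/eqP: s1sq; rewrite Ds eqn_mod_dvd ?leq_addr // addKn.
  by rewrite expnS expn1 dvdn_pmul2l.
by rewrite -addnA (mulnC k) -mulnDr addnC mulnC modnMDl.
Qed.

(** The sum of length p ^ (t + 1) factors as the sum of length p ^ t times the
sum of length p with ratio s ^ (p ^ t), which is still 1 mod p. *)
Lemma geom_sum_pow p s t :
    prime p -> s = 1 %[mod p] ->
  exists2 c, \sum_(i < p ^ t) s ^ i = p ^ t * c
    & odd p \/ s = 1 %[mod p ^ 2] -> c = 1 %[mod p].
Proof.
move=> p_pr s1; elim: t => [|t [c IHt c1]].
  by exists 1 => //; rewrite big_ord1.
have [d Dd d1] := geom_sum_prime p_pr (modn_exp1 (p ^ t) s1).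
exists (c * d) => [|cond]; first by rewrite expnSr geom_sum_mul IHt Dd mulnACA.
rewrite -modnMm c1 // d1 ?modnMm //.
by case: cond; [left | right; apply: modn_exp1].
Qed.

(** * Powers in the product of an element and a cyclic normal subgroup *)

Local Open Scope group_scope.

Lemma expg_mul_twisted (gT : finGroupType) (g x : gT) s k :
  x ^ g = x ^+ s -> (g * x) ^+ k = g ^+ k * x ^+ (\sum_(i < k) s ^ i)%N.
Proof.
move=> xg; elim: k => [|k IHk]; first by rewrite big_ord0 !mulg1.
have ->: (\sum_(i < k.+1) s ^ i = s * (\sum_(i < k) s ^ i) + 1)%N.
  rewrite big_ord_recl addnC big_distrr; congr (_ + _)%N.
  by apply: eq_bigr => i _; rewrite /= expnS.
rewrite expgSr IHk expgD expgM -xg -conjXg expg1 (expgSr g) -!mulgA.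
by rewrite mulKVg.
Qed.

(** The exponent s satisfies s ^ #[g] = 1 modulo the order of N, hence modulo p,
and s ^ #[g] = s mod p by Fermat, because #[g] is a power of p. *)
Lemma conj_expg (gT : finGroupType) p (N : {group gT}) g :
    prime p -> p.-group N -> cyclic N -> g \in 'N(N) -> p.-elt g ->
  exists2 s, s = 1 %[mod p] & {in N, forall x, x ^ g = x ^+ s}.
Proof.
move=> p_pr N_p N_cyclic Ng g_p; have [a Na] := cyclicP N_cyclic.
have [-> | N_neq1] := eqVneq N 1%G.
  by exists 1%N => // x; rewrite inE => /eqP->; rewrite conj1g expg1.
have /cycleP[s Ds] : a ^ g \in <[a]> by rewrite -Na memJ_norm // Na cycle_id.
have iter k : a ^ (g ^+ k) = a ^+ (s ^ k).
  elim: k => [|k IHk]; first by rewrite conjg1 expg1.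
  by rewrite expgSr conjgM IHk conjXg Ds -expgM expnS.
exists s => [|x]; last first.
  by rewrite Na => /cycleP[i ->]; rewrite conjXg Ds expgAC.
have p_dv_a: p %| #[a].
  by case: (pgroup_pdiv N_p N_neq1) => _; rewrite Na.
have [k Dk] := p_natP g_p.
have fermat j : s ^ (p ^ j) = s %[mod p].
  elim: j => [|j IHj]; first by rewrite expn1.
  by rewrite expnSr expnM fermat_little.
by rewrite -(fermat k) -Dk -(modn_dvdm (s ^ _) p_dv_a) -(modn_dvdm 1 p_dv_a);
  congr (_ %% _)%N; apply/eqP; rewrite -eq_expg_mod_order -iter expg_order conjg1.
Qed.

Lemma expg_pow_mul (gT : finGroupType) p (g x : gT) s t :
    prime p -> s = 1 %[mod p] -> x ^ g = x ^+ s ->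
  exists2 c, (g * x) ^+ (p ^ t) = g ^+ (p ^ t) * x ^+ (p ^ t * c)
    & odd p \/ s = 1 %[mod p ^ 2] -> c = 1 %[mod p].
Proof.
move=> p_pr s1 xg; have [c Dc c1] := geom_sum_pow t p_pr s1.
by exists c; rewrite // (expg_mul_twisted _ xg) Dc.
Qed.

(** * Beauville structures *)

Lemma SigmaP (gT : finGroupType) (G : {group gT}) x y t :
  reflect (exists2 g, g \in G & exists2 z, z \in [:: x; y; x * y] & t \in <[z]> :^ g)
          (t \in Sigma G x y).
Proof.
apply: (iffP bigcupP) => [[g Gg] | [g Gg [z]]].
  rewrite !inE -orbA => /or3P[] tz; exists g => //.
  - by exists x; rewrite ?inE ?eqxx.
  - by exists y; rewrite ?inE ?eqxx ?orbT.
  by exists (x * y); rewrite ?inE ?eqxx ?orbT.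
rewrite !inE => /or3P[] /eqP-> tz; exists g; rewrite // !inE tz ?orbT //.
Qed.

Lemma cycle_sub_Sigma (gT : finGroupType) (G : {group gT}) x y z :
  z \in [:: x; y; x * y] -> <[z]> \subset Sigma G x y.
Proof.
move=> xyz; apply/subsetP=> t zt; apply/SigmaP.
by exists 1 => //; exists z; rewrite ?conjsg1.
Qed.

(** The elements x * y and y * x are conjugate. *)
Lemma SigmaC (gT : finGroupType) (G : {group gT}) x y :
  x \in G -> y \in G -> Sigma G x y = Sigma G y x.
Proof.
suff half a b : b \in G -> Sigma G a b \subset Sigma G b a.
  by move=> Gx Gy; apply/eqP; rewrite eqEsubset !half.
move=> Gb; apply/subsetP=> t /SigmaP[g Gg [z]].
rewrite !inE => /or3P[] /eqP-> tz; apply/SigmaP.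
- by exists g => //; exists a; rewrite ?inE ?eqxx ?orbT.
- by exists g => //; exists b; rewrite ?inE ?eqxx ?orbT.
exists (b * g); first by rewrite groupM.
exists (b * a); first by rewrite !inE eqxx !orbT.
by rewrite conjsgM -cycleJ conjgE -!mulgA mulKg.
Qed.

Lemma Beauville_sym (gT : finGroupType) (G : {group gT}) x1 y1 x2 y2 :
  Beauville_structure G x1 y1 x2 y2 -> Beauville_structure G x2 y2 x1 y1.
Proof. by case=> gen1 gen2 TI; split; rewrite // setIC. Qed.

Lemma gen2_mem (gT : finGroupType) (G : {group gT}) x y :
  <<[set x; y]>> = G -> x \in G /\ y \in G.
Proof. by move=> <-; rewrite !mem_gen ?inE ?eqxx ?orbT. Qed.

Lemma Beauville_flip (gT : finGroupType) (G : {group gT}) x1 y1 x2 y2 :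
  Beauville_structure G x1 y1 x2 y2 -> Beauville_structure G x1 y1 y2 x2.
Proof.
case=> gen1 gen2 TI; have [Gx Gy] := gen2_mem gen2.
by split; rewrite // ?(SigmaC Gy Gx) // setUC.
Qed.

Lemma Beauville_TI (gT : finGroupType) (G : {group gT}) x1 y1 x2 y2 g h :
    Beauville_structure G x1 y1 x2 y2 ->
    g \in [:: x1; y1; x1 * y1] -> h \in [:: x2; y2; x2 * y2] ->
  <[g]> :&: <[h]> = 1.
Proof.
case=> _ _ TI g1 h2; apply/trivgP; move: TI => /= <-.
by apply: setISS; apply: cycle_sub_Sigma.
Qed.

(** The subgroups of the cyclic p-group G / N form a chain, so the larger of the
images of <[x]> and <[y]> is the whole quotient. *)
Lemma gen2_mod_cyclic (gT : finGroupType) (p : nat) (G N : {group gT}) x y :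
    p.-group G -> N <| G -> cyclic (G / N) -> <<[set x; y]>> = G ->
  N * <[x]> = G \/ N * <[y]> = G.
Proof.
move=> G_p /andP[sNG nNG] GN_cyclic gen; have [Gx Gy] := gen2_mem gen.
wlog sub: x y gen Gx Gy / (<[x]> / N \subset <[y]> / N)%g => [IH|].
  have [sx sy] : (<[x]> / N \subset G / N)%g /\ (<[y]> / N \subset G / N)%g.
    by rewrite !quotientS ?cycle_subG.
  have: (#|<[x]> / N| %| #|<[y]> / N|)%N || (#|<[y]> / N| %| #|<[x]> / N|)%N.
    have /p_natP[i ->]: p.-nat #|<[x]> / N| := pgroupS sx (quotient_pgroup N G_p).
    have /p_natP[j ->]: p.-nat #|<[y]> / N| := pgroupS sy (quotient_pgroup N G_p).
    by case/orP: (leq_total i j) => le_ij; rewrite (dvdn_exp2l _ le_ij) ?orbT.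
  rewrite !(cardSg_cyclic GN_cyclic) // => /orP[]; first exact: IH.
  by rewrite or_comm; apply: IH; rewrite // setUC.
right; apply/eqP; rewrite eqEsubset mul_subG ?cycle_subG //=.
rewrite -quotientSK // -{1}gen quotient_gen ?(subset_trans _ nNG) //; last first.
  by rewrite -gen subset_gen.
rewrite gen_subG quotientU subUset !quotient_set1 ?(subsetP nNG) //.
rewrite !sub1set (subsetP sub) ?mem_quotient ?cycle_id //.
Qed.

(** * Metacyclic Beauville p-groups are semidirect products *)

Lemma Beauville_metacyclic_sdprod (gT : finGroupType) (p : nat) (G N : {group gT}) :
    prime p -> p.-group G -> N <| G -> cyclic N -> cyclic (G / N) -> N :!=: 1 ->
    Beauville_group G ->
  odd p /\ exists2 u, N ><| <[u]> = G & #|N| = #[u].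
Proof.
move=> p_pr G_p nsNG N_cyc GN_cyc N_neq1 [x1 [y1 [u [v B]]]].
have [sNG nNG] := andP nsNG; have N_p := pgroupS sNG G_p.
have [_ p_dv_N _] := pgroup_pdiv N_p N_neq1; have [z Nz oz] := Cauchy p_pr p_dv_N.
wlog z2: x1 y1 u v B / z \notin Sigma G u v => [IH|].
  have [z2 | ] := boolP (z \in Sigma G u v); last exact: (IH _ _ _ _ B).
  apply: IH (Beauville_sym B) _; apply/negP=> z1.
  have [_ _ /setP/(_ z)] := B; rewrite !inE z1 z2 => /esym/eqP z1'.
  by move: (prime_gt1 p_pr); rewrite -oz z1' order1.
wlog defG: u v B z2 / N * <[u]> = G => [IH|].
  have [_ gen2 _] := B; have [Gu Gv] := gen2_mem gen2.
  have [] := gen2_mod_cyclic G_p nsNG GN_cyc gen2; first exact: IH B z2.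
  by apply: IH (Beauville_flip B) _; rewrite -SigmaC.
have [gen1 gen2 _] := B; have [Gu Gv] := gen2_mem gen2.
(* A nontrivial intersection would contain the subgroup of order p of N. *)
have TI2 g: g \in [:: u; v; u * v] -> N :&: <[g]> = 1.
  move=> uvg; apply/eqP; apply: contraR z2 => TIn1.
  have sIN: N :&: <[g]> \subset N := subsetIl _ _.
  have [_ p_dv_I _] := pgroup_pdiv (pgroupS sIN N_p) TIn1.
  have: <[z]> \subset N :&: <[g]>.
    by rewrite -(cardSg_cyclic N_cyc) ?cycle_subG // [#|_|]oz.
  rewrite cycle_subG inE => /andP[_].
  exact: (subsetP (cycle_sub_Sigma G uvg)).
have TIu: N :&: <[u]> = 1 by rewrite TI2 ?inE ?eqxx.
have nNu: <[u]> \subset 'N(N) by rewrite cycle_subG (subsetP nNG).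
have sdG: N ><| <[u]> = G by rewrite sdprodE.
have oG := sdprod_card sdG.
have decomp g: g \in G -> exists i, exists2 x, x \in N & g = u ^+ i * x.
  rewrite -defG -(normC nNu) => /mulsgP[_ x /cycleP[i ->] Nx ->].
  by exists i, x.
have [i [a Na Dv]] := decomp v Gv.
have defN: N :=: <[a]>.
  have saN: <[a]> \subset N by rewrite cycle_subG.
  have nau: <[u]> \subset 'N(<[a]>).
    by apply: char_norm_trans nNu; rewrite sub_cyclic_char.
  (* By the modular law, N = <[a]> * (<[u]> :&: N). *)
  apply/eqP; rewrite eqEsubset saN andbT.
  have sGau: G \subset <[a]> * <[u]>.
    have ua: u \in <[a]> <*> <[u]> by rewrite (subsetP (joing_subr _ _)) ?cycle_id.
    have aa: a \in <[a]> <*> <[u]> by rewrite (subsetP (joing_subl _ _)) ?cycle_id.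
    by rewrite -norm_joinEr // -gen2 gen_subG subUset !sub1set Dv ua groupM ?groupX.
  have: N \subset <[a]> * <[u]> :&: N by rewrite subsetI (subset_trans sNG sGau) subxx.
  by rewrite -group_modl // setIC TIu mulg1.
have oN: #|N| = #[a] by rewrite defN.
have Gp g : g \in G -> p.-elt g by move=> Gg; apply: mem_p_elt G_p Gg.
have [m ou] := p_natP (Gp u Gu).
have m_gt0: 0 < m.
  rewrite lt0n; apply: contraNneq N_neq1 => m0.
  have u1: u = 1 by apply/eqP; rewrite -order_eq1 ou m0.
  have va: v = a by rewrite Dv u1 expg1n mul1g.
  have: v \in N :&: <[v]> by rewrite inE cycle_id va Na.
  rewrite TI2 ?inE ?eqxx ?orbT // => /eqP v1.
  by rewrite defN -va v1 cycle1.
(* Otherwise raising to the power p ^ m.-1 kills N, so this power of an element g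
   that generates G modulo N lies in <[u]> :&: <[g]> = 1, and G is too small. *)
have Na_big: ~~ (#[a] %| p ^ m.-1)%N.
  apply/negP => a_small.
  have [g g1 genNg]: exists2 g, g \in [:: x1; y1; x1 * y1] & N * <[g]> = G.
    have [] := gen2_mod_cyclic G_p nsNG GN_cyc gen1.
      by exists x1; rewrite ?inE ?eqxx.
    by exists y1; rewrite ?inE ?eqxx ?orbT.
  have Gg: g \in G.
    by rewrite -genNg (subsetP (mulG_subr _ _)) ?cycle_id.
  have [j [x Nx Dg]] := decomp g Gg.
  have Guj: u ^+ j \in G by rewrite groupX.
  have [s s1 /(_ x Nx) xs] := conj_expg p_pr N_p N_cyc (subsetP nNG _ Guj) (Gp _ Guj).
  have [c Dgq _] := expg_pow_mul m.-1 p_pr s1 xs.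
  have gq: g ^+ (p ^ m.-1) = (u ^+ j) ^+ (p ^ m.-1).
    rewrite Dg Dgq (_ : x ^+ _ = 1) ?mulg1 //; apply/eqP; rewrite -order_dvdn.
    by apply/dvdn_mulr/(dvdn_trans _ a_small); rewrite -oN order_dvdG.
  have gq1: g ^+ (p ^ m.-1) = 1.
    have: g ^+ (p ^ m.-1) \in <[g]> :&: <[u]>.
      by rewrite inE mem_cycle gq !groupX ?cycle_id.
    by rewrite (Beauville_TI B g1 (mem_head _ _)) => /set1P.
  have: p ^ m <= p ^ m.-1.
    rewrite -ou -(leq_pmul2l (cardG_gt0 N)) oG -genNg.
    apply: (@leq_trans (#|N| * #[g])%N).
      by rewrite mul_cardG leq_pmulr ?cardG_gt0.
    by rewrite leq_mul2l dvdn_leq ?orbT ?expn_gt0 ?prime_gt0 // order_dvdn gq1.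
  by rewrite leq_exp2l ?prime_gt1 // -ltnS prednK // ltnn.
have [n oa] := p_natP (Gp a (subsetP sNG _ Na)).
have le_mn: m <= n by move: Na_big; rewrite oa dvdn_Pexp2l ?prime_gt1 // -ltnNge prednK.
(* The power p ^ t of u ^+ k * a is a ^+ (p ^ t * c) with c prime to p;
   it lies in N, hence is trivial. *)
have bound k t: u ^+ k * a \in [:: u; v; u * v] -> u ^+ k ^+ (p ^ t) = 1 ->
    odd p \/ p = 2%N /\ ~~ odd k -> (#[a] %| p ^ t)%N.
  move=> uvw uk1 cond; set w := _ * a in uvw.
  have Guj j : u ^+ j \in G by rewrite groupX.
  have [s s1 [as_ s1sq]]: exists2 s, s = 1 %[mod p] &
      a ^ (u ^+ k) = a ^+ s /\ (odd p \/ s = 1 %[mod p ^ 2]).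
    case: cond => [p_odd | [p2 k_even]].
      have [s s1 /(_ a Na) as_] :=
        conj_expg p_pr N_p N_cyc (subsetP nNG _ (Guj k)) (Gp _ (Guj k)).
      by exists s => //; split; last left.
    (* The exponent of an even power of u is a square, hence 1 mod 4. *)
    have [s s1 Ns] :=
      conj_expg p_pr N_p N_cyc (subsetP nNG _ (Guj k./2)) (Gp _ (Guj k./2)).
    exists (s ^ 2)%N; first exact: modn_exp1.
    split; last first.
      by right; rewrite p2; apply: sqr_mod4; rewrite -p2.
    rewrite -(even_halfK k_even) -addnn expgD conjgM !Ns ?groupX //.
    by rewrite -expgM.
  have [c Dwq /(_ s1sq) c1] := expg_pow_mul t p_pr s1 as_.
  have: w ^+ (p ^ t) \in N :&: <[w]>.
    by rewrite inE mem_cycle Dwq uk1 mul1g groupX.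
  rewrite (TI2 _ uvw) Dwq uk1 mul1g => /set1P/eqP.
  rewrite -order_dvdn Gauss_dvdl // oa coprimeXl // prime_coprime //.
  by rewrite /dvdn c1 modn_small ?prime_gt1.
have p_odd: odd p.
  have [p2 | //] := even_prime p_pr.
  have [k k_even uvw]: exists2 k, ~~ odd k & u ^+ k * a \in [:: u; v; u * v].
    have [i_odd | i_even] := boolP (odd i).
      exists i.+1; first by rewrite /= i_odd.
      by rewrite expgS -mulgA -Dv !inE eqxx !orbT.
    by exists i; rewrite // -Dv !inE eqxx orbT.
  case/negP: Na_big; apply: bound uvw _ _; last by right.
  apply/eqP; rewrite -expgM -order_dvdn ou -(even_halfK k_even) -muln2 -p2.
  by rewrite -mulnA -expnS prednK ?dvdn_mull.
split=> //; exists u => //.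
suff: (#[a] %| p ^ m)%N.
  rewrite oN oa ou dvdn_Pexp2l ?prime_gt1 // => le_nm.
  by congr (_ ^ _)%N; apply/eqP; rewrite eqn_leq le_nm.
apply: (bound i); rewrite -?Dv ?inE ?eqxx ?orbT //; last by left.
by apply/eqP; rewrite -expgM -order_dvdn ou dvdn_mull.
Qed.

(** * The power morphism onto the plane of elements of order p *)

Lemma expg_pow_modn (gT : finGroupType) p (x : gT) e c :
  x ^+ (p ^ e.+1) = 1 -> c = 1 %[mod p] -> x ^+ (p ^ e * c) = x ^+ (p ^ e).
Proof.
move=> x1 c1; have xq1: (x ^+ (p ^ e)) ^+ p = 1 by rewrite -expgM -expnSr.
by rewrite expgM -(expg_mod c xq1) c1 (expg_mod 1 xq1).
Qed.

(** Write phi for the power map. The power formula gives phi (g x) = phi g * phi x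
for x in <[a]>. Since an exponent that is 1 mod p acts trivially on phi x, the
elements phi x are central. The element phi (b ^+ i) commutes with a because
b ^+ i and its conjugate by a differ by the commutator [~ b ^+ i, a], which is a
p-th power in <[a]> and so is killed by phi. *)
Lemma pow_morphism (gT : finGroupType) p e (G : {group gT}) (a b : gT) :
    prime p -> odd p -> <[a]> ><| <[b]> = G ->
    #[a] = (p ^ e.+1)%N -> #[b] = (p ^ e.+1)%N ->
  exists f : {morphism G >-> gT},
    [/\ {in G, forall g, f g = g ^+ (p ^ e)}, f @* G \subset 'C(G)
      & {in G, forall g, g ^+ (p ^ e.+1) = 1}].
Proof.
move=> p_pr p_odd sdG oa ob.
have [/andP[sKG nKG] sHG defG nKH TI] := sdprod_context sdG.
have oG : #|G| = (p ^ (e.+1 + e.+1))%N.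
  by rewrite -(sdprod_card sdG) -!orderE oa ob expnD.
have G_p: p.-group G by rewrite /pgroup oG pnatX pnat_id.
have K_p := pgroupS sKG G_p; have K_cyc := cycle_cyclic a.
have decomp g: g \in G -> exists i, exists2 x, x \in <[a]> & g = b ^+ i * x.
  rewrite -defG -(normC nKH) => /mulsgP[_ x /cycleP[i ->] Kx ->].
  by exists i, x.
have Gb i: b ^+ i \in G by rewrite groupX // (subsetP sHG) ?cycle_id.
have K1 x: x \in <[a]> -> x ^+ (p ^ e.+1) = 1.
  by move=> Kx; apply/eqP; rewrite -order_dvdn -oa order_dvdG.
have conjK g: g \in G ->
    exists2 s, s = 1 %[mod p] & {in <[a]>, forall x, x ^ g = x ^+ s}.
  by move=> Gg; apply: conj_expg; rewrite ?(subsetP nKG) ?(mem_p_elt G_p).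
have G1 g: g \in G -> g ^+ (p ^ e.+1) = 1.
  move=> /decomp[i [x Kx ->]]; have [s s1 /(_ x Kx) xs] := conjK _ (Gb i).
  have [c -> _] := expg_pow_mul e.+1 p_pr s1 xs.
  by rewrite (expgM x) (K1 x) // expg1n mulg1 expgAC -ob expg_order expg1n.
pose phi (g : gT) := g ^+ (p ^ e).
have phiK g x: g \in G -> x \in <[a]> -> phi (g * x) = phi g * phi x.
  move=> Gg Kx; have [s s1 /(_ x Kx) xs] := conjK g Gg.
  have [c Dc c1] := expg_pow_mul e p_pr s1 xs.
  by rewrite /phi Dc expg_pow_modn ?K1 //; apply: c1; left.
have cK x: x \in <[a]> -> phi x \in 'C(G).
  move=> Kx; apply/centP=> g Gg; apply/commgP/conjg_fixP.
  have [s s1 /(_ x Kx) xs] := conjK g Gg.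
  by rewrite /phi conjXg xs expgAC -expgM expg_pow_modn ?K1.
have cb i: phi (b ^+ i) \in 'C(G).
  have Gbi := Gb i; rewrite -defG centM inE !cent_cycle.
  apply/andP; split; apply/cent1P; last first.
    by rewrite /phi -expgM; apply/commute_sym/commuteX.
  apply/commgP/conjg_fixP; rewrite /phi conjXg.
  have Ka := cycle_id a; have Kc: [~ b ^+ i, a] \in <[a]>.
    by rewrite commgEr groupM // memJ_norm ?groupV // (subsetP nKG).
  rewrite conjg_mulR -/(phi (_ * _)) phiK // (_ : phi [~ _, _] = 1) ?mulg1 //.
  have [s s1 /(_ a Ka) as_] := conjK _ Gbi.
  (* This commutator is a ^- s * a with s = 1 mod p. *)
  have ca: commute (a ^- 1 ^ (b ^+ i)) a.
    by rewrite conjVg as_; apply/commute_sym/commuteV; apply: commuteX.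
  rewrite /phi commgEr expgMn // conjVg as_ expgVn expgAC -expgM.
  by rewrite expg_pow_modn ?K1 ?mulVg.
have cG g: g \in G -> phi g \in 'C(G).
  by move=> /decomp[i [x Kx ->]]; rewrite phiK ?Gb // groupM ?cb ?cK.
have phiM: {in G &, {morph phi : x y / x * y}}.
  move=> g h Gg Gh; have [i [x Kx ->]] := decomp g Gg.
  have [j [y Ky ->]] := decomp h Gh.
  rewrite mulgA -(mulgA _ x) (conjgC x) mulgA -expgD -mulgA.
  have Kxb: x ^ (b ^+ j) \in <[a]> by rewrite memJ_norm // (subsetP nKG).
  rewrite (phiK (b ^+ i)) // (phiK (b ^+ j)) //.
  rewrite (phiK (b ^+ (i + j)) _ (Gb _) (groupM Kxb Ky)).
  rewrite (phiK (x ^ _)) ?(subsetP sKG (x ^ _)) //.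
  have ->: phi (x ^ (b ^+ j)) = phi x.
    by rewrite /phi -conjXg; apply/conjg_fixP/commgP/(centP (cK x Kx)).
  have -> : phi (b ^+ (i + j)) = phi (b ^+ i) * phi (b ^+ j).
    by rewrite /phi -!expgM mulnDl expgD.
  rewrite -!mulgA; congr (_ * _); rewrite !mulgA; congr (_ * _).
  apply: (centP (cb j)); rewrite groupX // (subsetP sKG) //.
exists (Morphism phiM); split=> //.
by apply/subsetP=> _ /morphimP[g _ Gg ->]; apply: cG.
Qed.

(** Collinear vectors (i, j) and (k, l) of the plane spanned by A and B have zero
determinant. *)
Lemma mem_cycle_mul_det (gT : finGroupType) (A B : gT) p i j k l :
    commute A B -> <[A]> :&: <[B]> = 1 -> #[A] = p -> #[B] = p ->
  A ^+ i * B ^+ j \in <[A ^+ k * B ^+ l]> -> i * l = j * k %[mod p].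
Proof.
move=> cAB TI oA oB /cycleP[t]; rewrite expgMn; last first.
  by apply: commuteX; apply/commute_sym; apply: commuteX; apply: commute_sym.
rewrite -!expgM => E.
have AB: A ^- (k * t) * A ^+ i = B ^+ (l * t) * B ^- j.
  rewrite -[LHS](mulgK (B ^+ j)) -mulgA (mulgA _ _ (B ^- j)) -!mulgA.
  by rewrite (mulgA (A ^+ i)) E !mulgA mulVg mul1g.
have AB1: A ^- (k * t) * A ^+ i = 1.
  apply/set1P; rewrite -[[set 1]]TI inE {2}AB.
  by rewrite !groupM ?groupV ?mem_cycle.
have iE : A ^+ (k * t) = A ^+ i by apply/eqP; rewrite eq_mulVg1 AB1.
have jE : B ^+ j = B ^+ (l * t) by apply: (mulgI (A ^+ i)); rewrite E iE.
move/eqP: iE; rewrite eq_expg_mod_order oA => /eqP iE.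
move/eqP: jE; rewrite eq_expg_mod_order oB => /eqP jE.
rewrite -modnMml -iE modnMml -[RHS]modnMml jE modnMml.
by rewrite -[(k * t * l)%N]mulnA mulnC (mulnC t).
Qed.

Lemma order_expn_prime (gT : finGroupType) p e (x : gT) :
  prime p -> #[x] = (p ^ e.+1)%N -> #[x ^+ (p ^ e)] = p.
Proof.
move=> p_pr ox; rewrite orderXdiv ox ?dvdn_exp2l // expnSr mulKn //.
by rewrite expn_gt0 prime_gt0.
Qed.

(** Of the four lines of the plane over the field with three elements, the first
triple takes up those of X, Y and X Y, where X and Y are the images of x1 and
y1. The images of x2 and y2 are then confined to the line of X Y ^+ 2, so they
cannot generate the plane. *)
Lemma sdprod_3group_not_Beauville (gT : finGroupType) e (G : {group gT}) (a b : gT) :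
    <[a]> ><| <[b]> = G -> #[a] = (3 ^ e.+1)%N -> #[b] = (3 ^ e.+1)%N ->
  ~ Beauville_group G.
Proof.
move=> sdG oa ob [x1 [y1 [x2 [y2 B]]]].
have [f [fE fC G1]] := pow_morphism (isT : prime 3) isT sdG oa ob.
have [/andP[sKG _] sHG _ _ TI] := sdprod_context sdG.
have [gen1 gen2 _] := B; have [Gx1 Gy1] := gen2_mem gen1; have [Gx2 Gy2] := gen2_mem gen2.
have fgen x y : x \in G -> y \in G -> <<[set x; y]>> = G -> <<[set f x; f y]>> = f @* G.
  move=> Gx Gy gen; have <-: f @* <<[set x; y]>> = f @* G by rewrite gen.
  rewrite morphim_gen ?subUset ?sub1set ?Gx //.
  by rewrite morphimU !morphim_set1.
have cf x y: x \in G -> y \in G -> commute (f x) (f y).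
  move=> Gx Gy; apply: (centP (subsetP fC _ (mem_morphim f Gx Gx))).
  by rewrite fE ?groupX.
have f3 x : x \in G -> f x ^+ 3 = 1 by move=> Gx; rewrite fE // -expgM -expnSr G1.
have TIf g h : g \in [:: x1; y1; x1 * y1] -> h \in [:: x2; y2; x2 * y2] ->
    g \in G -> h \in G -> f h \in <[f g]> -> f h = 1.
  move=> g1 h2 Gg Gh fh; apply/set1P; rewrite -[[set 1]](Beauville_TI B g1 h2) inE.
  rewrite {2}fE ?mem_cycle // andbT; apply: subsetP fh.
  by rewrite cycle_subG fE ?mem_cycle.
(* Any other f h would lie on a line of the first triple, so be trivial. *)
have key h : h \in [:: x2; y2; x2 * y2] -> h \in G -> f h \in <[f x1 * f y1 ^+ 2]>.
  move=> h2 Gh; have: f h \in <<[set f x1; f y1]>> by rewrite fgen ?mem_morphim.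
  have -> : <<[set f x1; f y1]>> = <[f x1]> <*> <[f y1]> by rewrite joing_idl joing_idr.
  rewrite cent_joinEr ?cent_cycle ?cycle_subG; last exact/cent1P/cf.
  case/mulsgP=> _ _ /cycleP[i ->] /cycleP[j ->].
  rewrite -(expg_mod i (f3 _ Gx1)) -(expg_mod j (f3 _ Gy1)).
  have lt3 k : (k %% 3)%N \in [:: 0; 1; 2]%N.
    by rewrite !inE; case: (k %% 3)%N (ltn_pmod k (isT : 0 < 3)) => [|[|[]]].
  have triv g : g \in [:: x1; y1; x1 * y1] -> g \in G -> f h \in <[f g]> ->
     f h \in <[f x1 * f y1 ^+ 2]>.
    by move=> g1 Gg /(TIf _ _ g1 h2 Gg Gh) ->; apply: group1.
  have t1 := triv _ (mem_head _ _) Gx1.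
  have t2 : f h \in <[f y1]> -> f h \in <[f x1 * f y1 ^+ 2]>.
    by apply: triv; rewrite // !inE eqxx orbT.
  have t3 : f h \in <[f x1 * f y1]> -> f h \in <[f x1 * f y1 ^+ 2]>.
    by rewrite -{1}morphM //; apply: triv; rewrite ?groupM // !inE eqxx !orbT.
  case: (i %% 3)%N (lt3 i) (j %% 3)%N (lt3 j) => [|[|[|//]]] _ [|[|[|//]]] _ fh.
  - by rewrite fh !mulg1 group1.
  - by apply: t2; rewrite // fh mul1g mem_cycle.
  - by apply: t2; rewrite // fh mul1g mem_cycle.
  - by apply: t1; rewrite // fh mulg1 mem_cycle.
  - by apply: t3; rewrite // fh cycle_id.
  - by rewrite fh cycle_id.
  - by apply: t1; rewrite // fh mulg1 mem_cycle.
  - have -> : f h = (f x1 * f y1 ^+ 2) ^+ 2; last by rewrite mem_cycle.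
    rewrite expgMn; last by apply: commuteX; apply: cf.
    by rewrite fh -(expgM _ 2 2) -(expg_mod (2 * 2) (f3 _ Gy1)).
  apply: t3; rewrite // fh -expgMn ?mem_cycle //; exact: cf.
have fG_cyc: f @* G \subset <[f x1 * f y1 ^+ 2]>.
  rewrite -(fgen x2 y2) // gen_subG subUset !sub1set !key //;
  by rewrite !inE eqxx ?orbT.
have Ga : a \in G by rewrite (subsetP sKG) ?cycle_id.
have Gb : b \in G by rewrite (subsetP sHG) ?cycle_id.
have oA : #[f a] = 3 by rewrite fE // (order_expn_prime _ oa).
have oB : #[f b] = 3 by rewrite fE // (order_expn_prime _ ob).
(* A cyclic group cannot contain both <[f a]> and <[f b]>, which have the same
   order. *)
have /trivgP : <[f a]> \subset [1].
  rewrite -TI subsetI {1}fE // cycleX /=.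
  apply: (subset_trans (B := <[f b]>)); last by rewrite fE // cycleX.
  rewrite -(cardSg_cyclic (cycle_cyclic (f x1 * f y1 ^+ 2))) -?orderE ?oA ?oB //.
    by rewrite cycle_subG (subsetP fG_cyc) ?mem_morphim.
  by rewrite cycle_subG (subsetP fG_cyc) ?mem_morphim.
by move/eqP; rewrite cycle_eq1 -order_eq1 oA.
Qed.

(** * Construction of Beauville structures *)

(** Any nontrivial subgroup of the cyclic p-group <[g]> contains its subgroup of
order p, generated by g ^+ (p ^ e), and conjugation by c fixes that element. *)
Lemma pow_mem_conj_cycle (gT : finGroupType) p e (g c t : gT) :
    prime p -> g ^+ (p ^ e.+1) = 1 -> g ^+ (p ^ e) != 1 ->
    commute (g ^+ (p ^ e)) c -> t \in <[g]> :^ c -> t != 1 ->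
  g ^+ (p ^ e) \in <[t]>.
Proof.
move=> p_pr g1 gq cq /imsetP[s gs ->{t}]; rewrite conjg_eq1 => s_neq1.
have og : #[g] %| p ^ e.+1 by rewrite order_dvdn g1.
have g_p : p.-group <[g]> by rewrite /pgroup (pnat_dvd og) // pnatX pnat_id.
have [_ p_dv_s _] : [/\ prime p, p %| #[s] & exists m, #[s] = (p ^ m.+1)%N].
  by apply: pgroup_pdiv; rewrite ?cycle_eq1 // (pgroupS _ g_p) // cycle_subG.
have oq : #[g ^+ (p ^ e)] = p by apply: nt_prime_order; rewrite // -expgM -expnSr.
have : <[g ^+ (p ^ e)]> \subset <[s]>.
  by rewrite -(cardSg_cyclic (cycle_cyclic g)) ?cycle_subG ?mem_cycle // -!orderE oq.
rewrite cycle_subG -(memJ_conjg _ c) -cycleJ.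
by have /conjg_fixP-> : [~ g ^+ (p ^ e), c] == 1 by apply/commgP.
Qed.

(** A nontrivial element t of the intersection generates a cyclic group that
contains the p ^ e-th powers of some g and h, one from each triple. Both powers
have order p, so they generate the same subgroup. *)
Lemma Sigma_TI (gT : finGroupType) p e (G : {group gT}) x1 y1 x2 y2 :
    prime p -> {in G, forall g, g ^+ (p ^ e.+1) = 1} ->
    {in G &, forall g h, commute (g ^+ (p ^ e)) h} ->
    x1 \in G -> y1 \in G -> x2 \in G -> y2 \in G ->
    {in [:: x1; y1; x1 * y1] & [:: x2; y2; x2 * y2], forall g h,
      g ^+ (p ^ e) \notin <[h ^+ (p ^ e)]> /\ h ^+ (p ^ e) \notin <[g ^+ (p ^ e)]>} ->
  Sigma G x1 y1 :&: Sigma G x2 y2 = 1.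
Proof.
move=> p_pr G1 Gc Gx1 Gy1 Gx2 Gy2 indep.
have mem3 x y z : x \in G -> y \in G -> z \in [:: x; y; x * y] -> z \in G.
  by move=> Gx Gy; rewrite !inE => /or3P[] /eqP->; rewrite ?groupM.
apply/eqP; rewrite eqEsubset; apply/andP; split; last first.
  rewrite sub1set inE !(subsetP (cycle_sub_Sigma G (mem_head _ _))) ?group1 //.
apply/subsetP=> t /setIP[/SigmaP[c Gc1 [g g1 tg]] /SigmaP[d Gd [h h1 th]]].
apply: contraT; rewrite in_set1 => t_neq1; have [gh hg] := indep g h g1 h1.
have Gg := mem3 _ _ _ Gx1 Gy1 g1; have Gh := mem3 _ _ _ Gx2 Gy2 h1.
have gq : g ^+ (p ^ e) != 1 by apply: contraNneq gh => ->.
have hq : h ^+ (p ^ e) != 1 by apply: contraNneq hg => ->.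
have tgq := pow_mem_conj_cycle p_pr (G1 _ Gg) gq (Gc _ _ Gg Gc1) tg t_neq1.
have thq := pow_mem_conj_cycle p_pr (G1 _ Gh) hq (Gc _ _ Gh Gd) th t_neq1.
have oq x : x \in G -> x ^+ (p ^ e) != 1 -> #[x ^+ (p ^ e)] = p.
  by move=> Gx xq; apply: nt_prime_order; rewrite // -expgM -expnSr G1.
case/negP: gh; rewrite -cycle_subG -(cardSg_cyclic (cycle_cyclic t)) ?cycle_subG //.
by rewrite -!orderE !oq.
Qed.

Lemma sdprod_Beauville (gT : finGroupType) p e (G : {group gT}) (a b : gT) :
    prime p -> 5 <= p -> <[a]> ><| <[b]> = G ->
    #[a] = (p ^ e.+1)%N -> #[b] = (p ^ e.+1)%N ->
  Beauville_group G.
Proof.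
move=> p_pr p_ge5 sdG oa ob.
have p_odd : odd p by case: (even_prime p_pr) p_ge5 => [->|].
have [f [fE fC G1]] := pow_morphism p_pr p_odd sdG oa ob.
have [/andP[sKG _] sHG defG nKH TI] := sdprod_context sdG.
have Ga : a \in G by rewrite (subsetP sKG) ?cycle_id.
have Gb : b \in G by rewrite (subsetP sHG) ?cycle_id.
have defGJ : <[a]> <*> <[b]> = G by rewrite norm_joinEr.
have gen_ab (M : {group gT}) : a \in M -> b \in M -> G \subset M.
  by move=> Ma Mb; rewrite -defGJ join_subG !cycle_subG Ma.
exists a, b, (a * b ^+ 2), (a * b ^+ 4); split.
- by rewrite -defGJ joing_idl joing_idr.
- set M := <<_>>; apply/eqP; rewrite eqEsubset gen_subG subUset !sub1set.
  rewrite !groupM ?groupX //=.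
  have Mab2 : a * b ^+ 2 \in M by rewrite mem_gen ?inE ?eqxx.
  have Mab4 : a * b ^+ 4 \in M by rewrite mem_gen ?inE ?eqxx ?orbT.
  have Mb2 : b ^+ 2 \in M.
    have -> : b ^+ 2 = (a * b ^+ 2)^-1 * (a * b ^+ 4).
      by rewrite invMg -mulgA mulKg (expgD b 2 2) mulKg.
    by rewrite groupM ?groupV.
  have Mb : b \in M.
    apply: (subsetP _ b (cycle_id b)).
    have /eqP -> : generator <[b]> (b ^+ 2).
      by rewrite generator_coprime ob coprimeXl // coprime_sym coprime2n.
    by rewrite cycle_subG.
  by apply: gen_ab; rewrite // -(groupMr _ Mb2).
have oA : #[f a] = p by rewrite fE // (order_expn_prime _ oa).
have oB : #[f b] = p by rewrite fE // (order_expn_prime _ ob).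
have cf x y : x \in G -> y \in G -> commute (f x) y.
  by move=> Gx Gy; apply: (centP (subsetP fC _ (mem_morphim f Gx Gx))).
have TIf : <[f a]> :&: <[f b]> = 1.
  by apply/trivgP; rewrite -TI !fE //; apply: setISS; apply: cycleX.
have cAB : commute (f a) (f b) by rewrite (fE b) //; apply: cf; rewrite ?groupX.
have indep i j k l g h : g \in G -> h \in G ->
    f g = f a ^+ i * f b ^+ j -> f h = f a ^+ k * f b ^+ l ->
    (i * l != j * k %[mod p])%N ->
  g ^+ (p ^ e) \notin <[h ^+ (p ^ e)]> /\ h ^+ (p ^ e) \notin <[g ^+ (p ^ e)]>.
  move=> Gg Gh Dg Dh det.
  rewrite -!fE // Dg Dh; split; apply: contra det => /(mem_cycle_mul_det cAB TIf oA oB).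
    by move/eqP.
  by move=> E; rewrite mulnC -E mulnC.
(* 6 = 2 * 3 comes from the line of (2, 6); the other values are less than 5. *)
have ndvd d : d \in [:: 1; 2; 3; 4; 6]%N -> ~~ (p %| d)%N.
  have lt5 k : 0 < k < 5 -> ~~ (p %| k)%N.
    by case/andP=> k_gt0 k_lt5; rewrite gtnNdvd // (leq_trans k_lt5).
  rewrite !inE => /or4P[/eqP->|/eqP->|/eqP->|]; try exact: lt5.
  by case/orP=> /eqP->; rewrite ?(Euclid_dvdM 2 3) // ?negb_or ?lt5.
have small m n : m < n -> n - m \in [:: 1; 2; 3; 4; 6]%N ->
    (m != n %[mod p])%N /\ (n != m %[mod p])%N.
  by move=> lt_mn /ndvd ndiff; rewrite [in X in X /\ _]eq_sym eqn_mod_dvd // ltnW.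
have fab : f (a * b) = f a ^+ 1 * f b ^+ 1 by rewrite morphM.
have fa : f a = f a ^+ 1 * f b ^+ 0 by rewrite mulg1.
have fb : f b = f a ^+ 0 * f b ^+ 1 by rewrite mul1g.
have fabX k : f (a * b ^+ k) = f a ^+ 1 * f b ^+ k.
  by rewrite morphM ?morphX ?groupX.
have fxy : f (a * b ^+ 2 * (a * b ^+ 4)) = f a ^+ 2 * f b ^+ 6.
  rewrite morphM ?groupM ?groupX // !fabX (expgD (f b) 2 4) (expgS (f a) 1) !expg1.
  move: (f b ^+ 2) (f b ^+ 4) (commuteX 2 cAB) => Y Z cY.
  by rewrite mulgA -(mulgA (f a) Y) -cY !mulgA.
apply: (Sigma_TI p_pr G1) => //; try by rewrite ?groupM ?groupX.
  by move=> g h Gg Gh; rewrite -fE //; apply: cf.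
move=> g h; rewrite !inE => /or3P[] /eqP-> /or3P[] /eqP->.
- by apply: (indep _ _ _ _ _ _ _ _ fa (fabX 2) (proj2 (small 0%N 2%N isT isT)));
    rewrite ?groupM ?groupX.
- by apply: (indep _ _ _ _ _ _ _ _ fa (fabX 4) (proj2 (small 0%N 4%N isT isT)));
    rewrite ?groupM ?groupX.
- by apply: (indep _ _ _ _ _ _ _ _ fa fxy (proj2 (small 0%N 6%N isT isT)));
    rewrite ?groupM ?groupX.
- by apply: (indep _ _ _ _ _ _ _ _ fb (fabX 2) (proj1 (small 0%N 1%N isT isT)));
    rewrite ?groupM ?groupX.
- by apply: (indep _ _ _ _ _ _ _ _ fb (fabX 4) (proj1 (small 0%N 1%N isT isT)));
    rewrite ?groupM ?groupX.
- by apply: (indep _ _ _ _ _ _ _ _ fb fxy (proj1 (small 0%N 2%N isT isT)));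
    rewrite ?groupM ?groupX.
- by apply: (indep _ _ _ _ _ _ _ _ fab (fabX 2) (proj2 (small 1%N 2%N isT isT)));
    rewrite ?groupM ?groupX.
- by apply: (indep _ _ _ _ _ _ _ _ fab (fabX 4) (proj2 (small 1%N 4%N isT isT)));
    rewrite ?groupM ?groupX.
- by apply: (indep _ _ _ _ _ _ _ _ fab fxy (proj2 (small 2%N 6%N isT isT)));
    rewrite ?groupM ?groupX.
Qed.

Theorem corollary2p9 (p : nat) (gT : finGroupType) (G : {group gT})
    (p_prime : prime p) (G_nontrivial : G :!=: 1) (G_pgroup : p.-group G)
    (G_metacyclic : metacyclic G) :
  Beauville_group G <-> (5 <= p /\ sdprod_cyclic_same_order G).
Proof.
split=> [BG | [p_ge5 [K [H [sdG cycK cycH oKH]]]]]; last first.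
  have [a Da] := cyclicP cycK; have [b Db] := cyclicP cycH.
  have [sKG _ _ _ _] := sdprod_context sdG.
  have [[|e] oK] : {e | #|K| = (p ^ e)%N}.
  - by apply: p_natP; apply: pgroupS (normal_sub sKG) G_pgroup.
  - by case/negP: G_nontrivial; rewrite trivg_card1 -(sdprod_card sdG) -oKH oK.
  apply: (sdprod_Beauville (a := a) (b := b) p_prime p_ge5).
  - by rewrite -Da -Db.
  - by rewrite orderE -Da oK.
  by rewrite orderE -Db -oKH oK.
have [N [N_cyc nsNG GN_cyc N_neq1]] : exists N : {group gT},
    [/\ cyclic N, N <| G, cyclic (G / N) & N :!=: 1].
  have /metacyclicP[N [N_cyc nsNG GN_cyc]] := G_metacyclic.
  (* If N = 1 then G is cyclic, and G itself will do. *)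
  have [N1 | ] := eqVneq (N : {set gT}) 1; last by exists N.
  exists G; split; rewrite ?normal_refl //; last by rewrite trivg_quotient cyclic1.
  by rewrite (isog_cyclic (quotient1_isog G)) -N1.
have [p_odd [u sdG oNu]] :=
  Beauville_metacyclic_sdprod p_prime G_pgroup nsNG N_cyc GN_cyc N_neq1 BG.
split; last by exists N, <[u]>%G; split; rewrite ?cycle_cyclic.
have [a Na] := cyclicP N_cyc.
have [[|e] oN] : {e | #|N| = (p ^ e)%N}.
- by apply: p_natP; apply: pgroupS (normal_sub nsNG) G_pgroup.
- by case/negP: N_neq1; rewrite trivg_card1 oN.
have p_neq3 : p != 3.
  apply/eqP=> p3; rewrite p3 in oN.
  apply: (sdprod_3group_not_Beauville (a := a) (b := u) _ _ _ BG); first by rewrite -Na.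
    by rewrite orderE -Na oN.
  by rewrite -oNu oN.
by case: p p_odd p_neq3 p_prime {G_pgroup oN} => [|[|[|[|[]]]]].
Qed.
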